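(* For every integer $k\ge 2$, the invariant $v_k:\mathscr{K}\to\mathbb{Q}$ is a Kauffman finite-type invariant of degree $k$, but it is not a GPV finite-type invariant of degree $\le n$ for any $n$. In particular, there is a fractional twist sequence $\Phi:\mathbb{Z}\to\mathscr{K}$ such that $v_k\circ\Phi$ is not a polynomial (of any degree) on $\mathbb{Z}$.
   Context: Long virtual knots: a long virtual knot diagram is a generic immersion $\mathbb{R}\to\mathbb{R}^2$, agreeing with the standard embedding of the $x$-axis outside a compact set, oriented along the positive $x$-direction, each double point marked as a classical over/under crossing or as a virtual crossing; $\mathscr{K}$ is the set of equivalence classes under Reidemeister and virtual moves. Each is encoded by a Gauss diagram: $\mathbb{R}$ with, for each classical crossing with preimages $x<y$, an arrow joining $x,y$ pointing right if the overcrossing is at $x$ and left if at $y$, labelled by the crossing's writhe sign. Jones–Kauffman polynomial: the Kauffman bracket $\langle\cdot\rangle$, with values in $\mathbb{Q}((A))$, is defined on unoriented long virtual diagrams possibly with additional closed components by: $\langle K\rangle = A\langle K_0\rangle + A^{-1}\langle K_\infty\rangle$ at a classical crossing (the two standard smoothings, $A$-smoothing and $A^{-1}$-smoothing), $\langle L\cup\bigcirc\rangle=(-A^2-A^{-2})\langle L\rangle$ for a closed component with no classical crossings, and $\langle\text{long component with no classical crossings}\rangle =1$. For an oriented long virtual knot $K$, $f_K(A)=(-A)^{-3w(K)}\langle|K|\rangle$, where $w(K)$ is the sum of the classical crossing signs. $v_k(K)$ denotes the coefficient of $x^k$ in the power series expansion of $f_K(e^x)$ about $x=0$. Finite type: an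 invariant $v$ is extended linearly; for a singular crossing $v(K_\times)=v(K_+)-v(K_-)$; for a semi-virtual crossing $v(K_{sv})=v(K_c)-v(K_{virt})$ (classical minus virtual crossing). $v$ is Kauffman finite-type of degree $\le n$ if it vanishes on all diagrams with $\ge n+1$ singular crossings, and of degree $n$ if it is of degree $\le n$ but not $\le n-1$; it is GPV finite-type of degree $\le n$ if it vanishes on all diagrams with $\ge n+1$ semi-virtual crossings. A function $f:\mathbb{Z}\to\mathbb{Q}$ is a polynomial of degree $\le n$ if all iterated differences $f(z+1)-f(z)$ of order $>n$ vanish. Fractional twist sequence: a proper pair in a Gauss diagram is a pair of disjoint open intervals $A<A'$ of $\mathbb{R}$ such that every arrow with an endpoint in $A\cup A'$ has one endpoint in each. Fix a Gauss diagram $G$ with a proper pair $(A,A')$ free of its endpoints, $Y\in\{S,B\}$ and $Z\in\{L,R\}$. $\Phi:\mathbb{Z}\to\mathscr{K}$ is a fractional twist sequence of type $FYZ$ if $\Phi(k)$ is $G$ together with $|k|$ arrows with endpoints $a_1<\dots<a_{|k|}$ in $A$, $b_1<\dots<b_{|k|}$ in $A'$, arrow $i$ joining $a_i$ to $b_i$ ($Y=S$) or to $b_{|k|+1-i}$ ($Y=B$), all pointing in direction $Z$ with sign $+$ when $k\ge0$, and all pointing opposite to $Z$ with sign $-$ when $k<0$. *)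

(* Defs.v *)
(* Long virtual knots via Gauss diagrams on the line (positions in rat). *)
From mathcomp Require Import all_boot all_order all_algebra.
Set Implicit Arguments. Unset Strict Implicit. Unset Printing Implicit Defensive.
Import Order.TTheory GRing.Theory Num.Theory.
Local Open Scope ring_scope.

(* An arrow joins the preimage [tl] of the OVERcrossing to the preimage [hd]
   of the undercrossing (so it "points right" iff tl < hd); [sgn] is the
   writhe sign of the crossing (true = +, false = -). *)
Record arrow := Arrow { tl : rat; hd : rat; sgn : bool }.

Definition gauss := seq arrow.

Definition endpoints (G : gauss) : seq rat :=
  flatten [seq [:: tl a; hd a] | a <- G].

Definition wf_gauss (G : gauss) : bool := uniq (endpoints G).

Definition ps := nat -> rat.
Definition ps_zero : ps := fun _ => 0.
Definition ps_one : ps := fun n => (n == 0)%N%:R.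
Definition ps_add (f g : ps) : ps := fun n => f n + g n.
Definition ps_opp (f : ps) : ps := fun n => - f n.
Definition ps_scale (c : rat) (f : ps) : ps := fun n => c * f n.
Definition ps_mul (f g : ps) : ps := fun n => \sum_(i < n.+1) f i * g (n - i)%N.
Definition ps_pow (f : ps) (c : nat) : ps := iter c (ps_mul f) ps_one.
Definition ps_sum (L : seq ps) : ps := foldr ps_add ps_zero L.
(* the power series of e^{j x}, i.e. the image of the monomial A^j under A := e^x *)
Definition ps_exp (j : int) : ps := fun n => (j%:~R : rat) ^+ n / (n`!)%:R.

Definition positions (G : gauss) : seq rat := sort (fun x y : rat => x <= y) (endpoints G).
Definition pidx (G : gauss) (x : rat) : nat := index x (positions G).

(* Nodes of the smoothed curve: 0 = start (-oo), 2m+1 = end (+oo); the i-th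
   endpoint (0-based, in the order of the line) has incoming node 2i+1 and
   outgoing node 2i+2.  Line segments join 2i to 2i+1 for i = 0..m. *)
Definition line_edges (m : nat) : seq (nat * nat) :=
  [seq (2 * i, 2 * i + 1)%N | i <- iota 0 m.+1].

(* Smoothing at an arrow; [s = true] is the A-smoothing.  The A-smoothing of
   a positive crossing is the oriented (Seifert) smoothing, that of a negative
   crossing the unoriented one; so the smoothing is oriented iff s == sgn a.
   Oriented: in_p -- out_q, in_q -- out_p.  Unoriented: in_p -- in_q, out_p -- out_q. *)
Definition chord_edges (G : gauss) (a : arrow) (s : bool) : seq (nat * nat) :=
  let i := pidx G (tl a) in let j := pidx G (hd a) in
  if s == sgn a then [:: (2 * i + 1, 2 * j + 2)%N; (2 * j + 1, 2 * i + 2)%N]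
  else [:: (2 * i + 1, 2 * j + 1)%N; (2 * i + 2, 2 * j + 2)%N].

Definition state_edges (G : gauss) (st : seq bool) : seq (nat * nat) :=
  line_edges (size (endpoints G)) ++
  flatten [seq chord_edges G p.1 p.2 | p <- zip G st].

Definition adj (E : seq (nat * nat)) (N : nat) : rel 'I_N :=
  fun x y => ((x : nat, y : nat) \in E) || ((y : nat, x : nat) \in E).

Definition ncomp (G : gauss) (st : seq bool) : nat :=
  let N := (2 * size (endpoints G) + 2)%N in
  n_comp (@adj (state_edges G st) N) (@predT 'I_N).

(* number of closed components (the long component is not counted) *)
Definition loops (G : gauss) (st : seq bool) : nat := (ncomp G st).-1.

Fixpoint states (n : nat) : seq (seq bool) :=
  match n with
  | 0 => [:: [::]]
  | n'.+1 => [seq b :: s | b <- [:: true; false], s <- states n']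
  end.

Definition ps_delta : ps := ps_add (ps_opp (ps_exp 2)) (ps_opp (ps_exp (-2))).

Definition bracket_ps (G : gauss) : ps :=
  ps_sum [seq ps_mul (ps_exp ((count id st)%:Z - (count negb st)%:Z))
                     (ps_pow ps_delta (loops G st)) | st <- states (size G)].

Definition writhe (G : gauss) : int := \sum_(a <- G) (if sgn a then 1 else -1).

Definition fK_ps (G : gauss) : ps :=
  ps_scale ((-1 : rat) ^ (- (3%:Z * writhe G)))
           (ps_mul (ps_exp (- (3%:Z * writhe G))) (bracket_ps G)).

Definition vk (k : nat) (G : gauss) : rat := fK_ps G k.

(* Singular crossings: a singular chord (p,q) resolves to K_+ with arrow p->q of
   sign + and to K_- (crossing change) with arrow q->p of sign -. *)
Fixpoint vsing (v : gauss -> rat) (G : gauss) (S : seq (rat * rat)) : rat :=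
  match S with
  | [::] => v G
  | pq :: S' => vsing v (Arrow pq.1 pq.2 true :: G) S'
                - vsing v (Arrow pq.2 pq.1 false :: G) S'
  end.

Definition kauffman_le (v : gauss -> rat) (n : nat) : Prop :=
  forall (G : gauss) (S : seq (rat * rat)),
    wf_gauss (G ++ [seq Arrow pq.1 pq.2 true | pq <- S]) ->
    (n < size S)%N -> vsing v G S = 0.

Definition kauffman_deg (v : gauss -> rat) (n : nat) : Prop :=
  kauffman_le v n /\ ~ kauffman_le v n.-1.

(* Semi-virtual crossings: v(K_sv) = v(K_c) - v(K_virt), i.e. keep the arrow
   minus delete it. *)
Fixpoint vsv (v : gauss -> rat) (G : gauss) (T : seq arrow) : rat :=
  match T with
  | [::] => v G
  | a :: T' => vsv v (a :: G) T' - vsv v G T'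
  end.

Definition gpv_le (v : gauss -> rat) (n : nat) : Prop :=
  forall (G T : gauss), wf_gauss (G ++ T) -> (n < size T)%N -> vsv v G T = 0.

Definition fdiff (f : int -> rat) : int -> rat := fun z => f (z + 1) - f z.

Definition poly_le (n : nat) (f : int -> rat) : Prop :=
  forall m : nat, (n < m)%N -> forall z : int, iter m fdiff f z = 0.

Definition in_open (lo hi x : rat) : bool := (lo < x) && (x < hi).

Definition proper_pair (G : gauss) (lo hi lo' hi' : rat) : Prop :=
  lo < hi /\ hi <= lo' /\ lo' < hi' /\
  all (fun a =>
    (in_open lo hi (tl a) || in_open lo' hi' (tl a) ||
     in_open lo hi (hd a) || in_open lo' hi' (hd a)) ==>
    ((in_open lo hi (tl a) && in_open lo' hi' (hd a)) ||
     (in_open lo' hi' (tl a) && in_open lo hi (hd a)))) G.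

Definition free_of_endpoints (G : gauss) (lo hi lo' hi' : rat) : Prop :=
  forall x, x \in endpoints G -> ~~ in_open lo hi x && ~~ in_open lo' hi' x.

Inductive twistY := TS | TB.   (* S = parallel, B = nested *)
Inductive twistZ := TL | TR.

(* the |k| new arrows, a_i in A, b_i in A' (both increasing) *)
Definition twist_arrows (Y : twistY) (Z : twistZ) (k : int) (as_ bs : seq rat) : seq arrow :=
  let bs' := if Y is TS then bs else rev bs in
  [seq let x := p.1 in let y := p.2 in
       if (0 <= k) then (if Z is TR then Arrow x y true else Arrow y x true)
       else (if Z is TR then Arrow y x false else Arrow x y false)
  | p <- zip as_ bs'].

Definition twist_sequence (Phi : int -> gauss) : Prop :=
  exists (G : gauss) (lo hi lo' hi' : rat) (Y : twistY) (Z : twistZ),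
    wf_gauss G /\ proper_pair G lo hi lo' hi' /\ free_of_endpoints G lo hi lo' hi' /\
    forall k : int, exists as_ bs : seq rat,
      [/\ size as_ = `|k|%N /\ size bs = `|k|%N,
          sorted (fun x y : rat => x < y) as_ /\ sorted (fun x y : rat => x < y) bs,
          all (in_open lo hi) as_ /\ all (in_open lo' hi') bs &
          Phi k = G ++ twist_arrows Y Z k as_ bs].

(* Main.v *)
(** A twist region made of parallel chords acts through the commutative algebra
    spanned by [1], the transposition [s] and the cup-cap [e], with [s^2 = 1],
    [s e = e] and [e^2 = delta e]: the oriented smoothing of a chord is [s], the
    unoriented one is [e].  Its three characters turn the normalised bracket [f]
    of [n] parallel chords into a sum of three exponentials in [n],
      [2 delta f = 2 (O + delta U)^n + (delta^2 + delta - 2) O^n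
                   + (delta - delta^2) (- O)^n],
    where [O] and [U] are the normalised weights of the two smoothings.  For
    positive chords and [A = e^x] the bases are [1], [-1] and [1] at [x = 0],
    and the coefficient of the alternating term is [12 x^2 + ...]; hence the
    coefficient of [x^k], [k >= 2], is not polynomial in [n].  For singular
    chords the bases are [-12 x], [4 x] and [-4 x] to first order, so that the
    degree [k] is attained.  The degree is at most [k] because both smoothings of
    a singular crossing have weight divisible by [x]. *)
From HB Require Import structures.
Require Import Defs.
From mathcomp Require Import all_boot all_order all_algebra.
From mathcomp Require Import boolp.
From mathcomp Require Import ring lra zify.
Set Implicit Arguments. Unset Strict Implicit. Unset Printing Implicit Defensive.
Import Order.TTheory GRing.Theory Num.Theory.
Local Open Scope ring_scope.

(** * Power series *)

Lemma psP (f g : ps) : (forall n, f n = g n) -> f = g.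
Proof. by move=> fg; apply/funext. Qed.

(** A coefficient of a product involves only a truncation of the factors, so the ring laws of power
    series can be borrowed from polynomials. *)
Lemma ps_mul_poly (f g : ps) n N : (n < N)%N ->
  ps_mul f g n = (\poly_(i < N) f i * \poly_(i < N) g i)`_n.
Proof.
move=> nN; rewrite coefM /ps_mul; apply: eq_bigr => i _.
have iN : (i < N)%N by apply: leq_ltn_trans nN; rewrite -ltnS.
have niN : (n - i < N)%N by apply: leq_ltn_trans nN; rewrite leq_subr.
by rewrite !coef_poly iN niN.
Qed.

Lemma ps_mulC : commutative ps_mul.
Proof. by move=> f g; apply/psP=> n; rewrite !(@ps_mul_poly _ _ _ n.+1) // mulrC. Qed.

Lemma ps_mul1 : left_id ps_one ps_mul.
Proof.
move=> f; apply/psP=> n; rewrite /ps_mul big_ord_recl big1 => [|i _].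
  by rewrite /ps_one /= subn0 mul1r addr0.
by rewrite /ps_one /= mul0r.
Qed.

Lemma ps_mulDl : left_distributive ps_mul ps_add.
Proof.
move=> f g h; apply/psP=> n; rewrite /ps_mul /ps_add -big_split.
by apply: eq_bigr => i _; rewrite mulrDl.
Qed.

Lemma ps_mulA : associative ps_mul.
Proof.
have trunc (f g h : ps) n :
  ps_mul (ps_mul f g) h n =
  (\poly_(i < n.+1) f i * \poly_(i < n.+1) g i * \poly_(i < n.+1) h i)`_n.
  rewrite [LHS]/ps_mul coefM; apply: eq_bigr => i _.
  by rewrite (@ps_mul_poly _ _ _ n.+1) // coef_poly ltnS leq_subr.
move=> f g h; apply/psP=> n.
by rewrite trunc ps_mulC trunc [in LHS]mulrC mulrA.
Qed.

Lemma ps_addA : associative ps_add.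
Proof. by move=> f g h; apply/psP=> n; exact: addrA. Qed.
Lemma ps_addC : commutative ps_add.
Proof. by move=> f g; apply/psP=> n; exact: addrC. Qed.
Lemma ps_add0 : left_id ps_zero ps_add.
Proof. by move=> f; apply/psP=> n; exact: add0r. Qed.
Lemma ps_addN : left_inverse ps_zero ps_opp ps_add.
Proof. by move=> f; apply/psP=> n; exact: addNr. Qed.
Lemma ps_one_neq0 : ps_one != ps_zero.
Proof. by apply/eqP=> /(congr1 (fun f : ps => f 0%N)). Qed.

HB.instance Definition _ := gen_eqMixin ps.
HB.instance Definition _ := gen_choiceMixin ps.
HB.instance Definition _ :=
  GRing.isZmodule.Build ps ps_addA ps_addC ps_add0 ps_addN.
HB.instance Definition _ :=
  GRing.Zmodule_isComNzRing.Build ps ps_mulA ps_mulC ps_mul1 ps_mulDl ps_one_neq0.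

Lemma psDE (f g : ps) n : (f + g) n = f n + g n. Proof. by []. Qed.
Lemma psNE (f : ps) n : (- f) n = - f n. Proof. by []. Qed.
Lemma ps1E n : (1 : ps) n = (n == 0)%N%:R. Proof. by []. Qed.
Lemma psME (f g : ps) n : (f * g) n = \sum_(i < n.+1) f i * g (n - i)%N.
Proof. by []. Qed.

Lemma ps_mulE (f g : ps) : ps_mul f g = f * g. Proof. by []. Qed.

Lemma ps_sumE (L : seq ps) : ps_sum L = \sum_(f <- L) f.
Proof. by rewrite unlock; elim: L => //= f L ->. Qed.

Lemma ps_powE (f : ps) c : ps_pow f c = f ^+ c.
Proof. by elim: c => [//|c IH]; rewrite exprS -IH. Qed.

Lemma ps_exp0 : ps_exp 0 = 1.
Proof.
apply/psP=> -[|n]; rewrite ps1E /ps_exp ?expr0 ?fact0 ?divr1 //.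
by rewrite mulr0z expr0n mul0r.
Qed.

Lemma ps_expD i j : ps_exp (i + j) = ps_exp i * ps_exp j.
Proof.
apply/psP=> n; rewrite psME /ps_exp addrC intrD exprDn mulr_suml.
apply: eq_bigr => k _.
have kn : (k <= n)%N by rewrite -ltnS.
have nz m : (m`!)%:R != 0 :> rat by rewrite pnatr_eq0 -lt0n fact_gt0.
have -> : n`!%:R = 'C(n, k)%:R * (k`!%:R * (n - k)`!%:R) :> rat.
  by rewrite -(bin_fact kn) !natrM.
have Cnz : 'C(n, k)%:R != 0 :> rat by rewrite pnatr_eq0 -lt0n bin_gt0.
by rewrite -mulr_natr; field; rewrite !nz.
Qed.

Lemma ps_scaleE c f : ps_scale c f = ps_scale c 1 * f.
Proof.
apply/psP=> n; rewrite psME big_ord_recl big1 => [|i _].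
  by rewrite /ps_scale ps1E /= subn0 mulr1 addr0.
by rewrite /ps_scale ps1E /= mulr0 mul0r.
Qed.

(** * Order of vanishing at x = 0: divisibility by powers of x and leading coefficients *)

Definition vanish (n : nat) (f : ps) := forall i, (i < n)%N -> f i = 0.

Lemma vanish0 f : vanish 0 f. Proof. by []. Qed.

Lemma vanishW m n f : (m <= n)%N -> vanish n f -> vanish m f.
Proof. by move=> mn fn i im; apply: fn; apply: leq_trans mn. Qed.

Lemma vanishD n f g : vanish n f -> vanish n g -> vanish n (f + g).
Proof. by move=> fn gn i i_n; rewrite psDE fn // gn // addr0. Qed.

Lemma vanishM a b f g : vanish a f -> vanish b g -> vanish (a + b) (f * g).
Proof.
move=> fa gb n nab; rewrite psME big1 // => i _.
case: (ltnP i a) => ia; first by rewrite fa // mul0r.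
by rewrite gb ?mulr0 //; move: (ltn_ord i); lia.
Qed.

Lemma coef_vanishM a b f g :
  vanish a f -> vanish b g -> (f * g) (a + b)%N = f a * g b.
Proof.
move=> fa gb; rewrite psME.
have aL : (a < (a + b).+1)%N by lia.
rewrite (bigD1 (Ordinal aL)) //= addKn big1 ?addr0 // => i /eqP/val_eqP/= ia.
case: (ltnP i a) => ia'; first by rewrite fa // mul0r.
by rewrite gb ?mulr0 //; move: (ltn_ord i) ia => /=; lia.
Qed.

Lemma vanishX f n : vanish 1 f -> vanish n (f ^+ n).
Proof.
move=> f1; elim: n => [|n IH]; first exact: vanish0.
by rewrite exprS -add1n; apply: vanishM.
Qed.

Lemma coef_vanishX f n : vanish 1 f -> (f ^+ n) n = f 1%N ^+ n.
Proof.
move=> f1; elim: n => [|n IH]; first by rewrite !expr0.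
by rewrite exprS -[n.+1]add1n coef_vanishM ?IH ?exprS //; apply: vanishX.
Qed.

(** * State sums *)

Lemma states_cons n (F : seq bool -> ps) :
  \sum_(st <- states n.+1) F st =
  \sum_(st <- states n) F (true :: st) + \sum_(st <- states n) F (false :: st).
Proof. by rewrite /= cats0 big_cat !big_map. Qed.

Lemma size_states n st : st \in states n -> size st = n.
Proof.
elim: n st => [|n IH] st /=; first by rewrite inE => /eqP->.
by rewrite cats0 mem_cat => /orP[] /mapP[s /IH <- ->].
Qed.

(** Translates between recording a smoothing by its power of A and recording whether it is oriented.
    One formula serves both directions, since comparison with a fixed boolean is an involution. *)
Definition flip (G : gauss) (st : seq bool) : seq bool :=
  [seq p.2 == sgn p.1 | p <- zip G st].

Lemma size_flip G st : size st = size G -> size (flip G st) = size G.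
Proof. by move=> szs; rewrite size_map size1_zip ?szs. Qed.

Lemma flipK G st : size st = size G -> flip G (flip G st) = st.
Proof.
rewrite /flip; elim: G st => [|a G IH] [|b st] //= [/IH ->].
by congr (_ :: _); case: b (sgn a) => [] [].
Qed.

Lemma sum_states_flip G (F : seq bool -> ps) :
  \sum_(st <- states (size G)) F st = \sum_(o <- states (size G)) F (flip G o).
Proof.
elim: G F => [|a G IH] F; first by rewrite /= !big_seq1.
rewrite [size _]/= !states_cons !(IH (fun st => F (_ :: st))) /flip /=.
by case: (sgn a); rewrite // addrC.
Qed.

(** Sorting the two endpoints forgets the direction, so an arrow and its crossing change yield the
    same chord. *)
Definition chord (a : arrow) : rat * rat :=
  (Num.min (tl a) (hd a), Num.max (tl a) (hd a)).

(** For positive arrows the A-smoothing is the oriented one, so a state of this diagram is directly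
    a list of choices oriented or not. *)
Definition positive_diagram (cs : seq (rat * rat)) : gauss :=
  [seq Arrow c.1 c.2 true | c <- cs].

(* [b] is the writhe sign, [o] tells whether the smoothing is oriented; the
   factor (-A)^{-3} of the writhe normalisation is included. *)
Definition weight (b o : bool) : ps :=
  - ps_exp (if b then if o then -2 else -4 else if o then 2 else 4).

Lemma writhe_factor G :
  ps_scale ((-1 : rat) ^ (- (3%:Z * writhe G))) (ps_exp (- (3%:Z * writhe G))) =
  \prod_(a <- G) - ps_exp (if sgn a then -3 else 3).
Proof.
elim: G => [|a G IH].
  rewrite big_nil /writhe big_nil ps_exp0 expr0z.
  by apply/psP=> n; rewrite /ps_scale mul1r.
rewrite big_cons -IH /writhe big_cons mulrDr opprD ps_expD expfzDr //.
have scaleM (c d : rat) : ps_scale (c * d) 1 = ps_scale c 1 * ps_scale d 1.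
  by rewrite -ps_scaleE; apply/psP=> n; rewrite /ps_scale mulrA.
have scaleN1 : ps_scale (-1) 1 = -1.
  by apply/psP=> n; rewrite /ps_scale psNE mulN1r.
rewrite ps_scaleE [in RHS]ps_scaleE scaleM.
have -> : (-1 : rat) ^ (- (3%:Z * (if sgn a then 1 else -1))) = -1.
  by case: (sgn a).
have -> : - (3%:Z * (if sgn a then 1 else -1)) = if sgn a then -3 else 3.
  by case: (sgn a).
by rewrite scaleN1; ring.
Qed.

Lemma state_factor (st : seq bool) :
  ps_exp ((count id st)%:Z - (count negb st)%:Z) =
  \prod_(b <- st) ps_exp (if b then 1 else -1).
Proof.
elim: st => [|b st IH]; first by rewrite big_nil /= subrr ps_exp0.
rewrite big_cons -IH -ps_expD; congr ps_exp.
by case: b => /=; rewrite ?add1n ?add0n; lia.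
Qed.

Lemma positions_perm (G H : gauss) :
  perm_eq (endpoints G) (endpoints H) -> positions G = positions H.
Proof.
move=> GH; apply/perm_sortP => //.
- exact: le_total.
- exact: le_trans.
- exact: le_anti.
Qed.

Lemma endpoints_chords G :
  perm_eq (endpoints G) (endpoints (positive_diagram (map chord G))).
Proof.
elim: G => [//|a G IH]; rewrite /endpoints /=.
case: (leP (tl a) (hd a)) => _; first by rewrite !perm_cons.
by rewrite (perm_catCA [:: tl a] [:: hd a] _) /= !perm_cons.
Qed.

Lemma eq_ncomp_adj (G H : gauss) st st' :
  size (endpoints G) = size (endpoints H) ->
  (forall x y, ((x, y) \in state_edges G st) || ((y, x) \in state_edges G st) =
     ((x, y) \in state_edges H st') || ((y, x) \in state_edges H st')) ->
  ncomp G st = ncomp H st'.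
Proof.
move=> sz adjE; rewrite /ncomp sz; set N := (2 * _ + 2)%N.
have eqc : connect (@adj (state_edges G st) N) =2 connect (@adj (state_edges H st') N).
  by apply: eq_connect => x y; apply: adjE.
by apply: eq_n_comp.
Qed.

(** Exchanging the ends of a chord swaps the two edges of the oriented smoothing and reverses each
    edge of the unoriented one, so the undirected smoothing graph is unchanged. *)
Lemma loops_flip G st : size st = size G ->
  loops G st = loops (positive_diagram (map chord G)) (flip G st).
Proof.
move=> szs; congr _.-1.
have pE := endpoints_chords G.
apply: eq_ncomp_adj; first exact: perm_size.
move=> x y; rewrite /state_edges (perm_size pE) !mem_cat.
set L := line_edges _.
rewrite orbACA [in RHS]orbACA; congr (_ || _).
rewrite /chord_edges /pidx -(positions_perm pE).
move: (positions G) => pos {pE L}.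
elim: G st szs => [|a G IH] [|b st] //= [/IH {}IH].
rewrite !mem_cat orbACA IH [in RHS]orbACA; congr (_ || _).
case: (leP (tl a) (hd a)) => _ /=; case: (b == sgn a) => //=;
  rewrite !inE !xpair_eqE;
  move: (index (tl a) pos) (index (hd a) pos) => i j.
all: lia.
Qed.

(** Signs enter only through [weight], while [C] sees only chords and smoothings. Leaving [C]
    arbitrary permits induction on arrows: the smoothing of a removed arrow is absorbed into [C]. *)
Definition state_sum (C : seq (rat * rat) -> seq bool -> ps) (G : gauss) : ps :=
  \sum_(o <- states (size G))
     (\prod_(p <- zip G o) weight (sgn p.1) p.2) * C (map chord G) o.

Lemma state_sum_cons C a G :
  state_sum C (a :: G) =
  weight (sgn a) true * state_sum (fun cs o => C (chord a :: cs) (true :: o)) G +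
  weight (sgn a) false * state_sum (fun cs o => C (chord a :: cs) (false :: o)) G.
Proof.
rewrite /state_sum [size _]/= states_cons !mulr_sumr.
by congr (_ + _); apply: eq_bigr => o _; rewrite /= big_cons mulrA.
Qed.

(** The writhe factor and the state factor both split over the arrows; at each arrow they multiply
    to its [weight]. *)
Lemma fK_state_sum G :
  fK_ps G = state_sum (fun cs o => ps_delta ^+ loops (positive_diagram cs) o) G.
Proof.
rewrite /fK_ps ps_scaleE ps_mulE mulrA -ps_scaleE writhe_factor.
rewrite /bracket_ps ps_sumE big_map sum_states_flip mulr_sumr.
apply: eq_big_seq => o /size_states szo.
rewrite ps_powE state_factor (loops_flip (size_flip szo)) flipK //.
rewrite ps_mulE mulrA; congr (_ * _).
rewrite /flip; elim: G o szo => [|a G IH] [|b o] //.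
  by rewrite !big_nil mulr1.
case=> /IH {}IH.
rewrite !big_cons -IH mulrACA; congr (_ * _).
by rewrite /= /weight mulNr -ps_expD; case: (sgn a) b => [] [].
Qed.

Lemma state_sum_eq C C' G :
  (forall o, size o = size G -> C (map chord G) o = C' (map chord G) o) ->
  state_sum C G = state_sum C' G.
Proof. by move=> CC; apply: eq_big_seq => o /size_states/CC->. Qed.

(** * Alternating sums over singular and semi-virtual crossings, for all coefficients at once *)

Definition ps_vsing (F : gauss -> ps) G S : ps := fun n => vsing (fun H => F H n) G S.

Definition ps_vsv (F : gauss -> ps) G T : ps := fun n => vsv (fun H => F H n) G T.

Lemma ps_vsing_cons F G s S : ps_vsing F G (s :: S) =
  ps_vsing F (Arrow s.1 s.2 true :: G) S - ps_vsing F (Arrow s.2 s.1 false :: G) S.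
Proof. by []. Qed.

Lemma ps_vsv_cons F G a T : ps_vsv F G (a :: T) = ps_vsv F (a :: G) T - ps_vsv F G T.
Proof. by []. Qed.

(** The last singular chord resolved becomes the head arrow, exactly the one that [state_sum_cons]
    splits off. *)
Lemma ps_vsing_rcons F G S s : ps_vsing F G (rcons S s) =
  ps_vsing (fun H => F (Arrow s.1 s.2 true :: H) - F (Arrow s.2 s.1 false :: H)) G S.
Proof. by elim: S G => [//|t S IH] G; rewrite rcons_cons !ps_vsing_cons !IH. Qed.

Lemma ps_vsingD F F' G S :
  ps_vsing (fun H => F H + F' H) G S = ps_vsing F G S + ps_vsing F' G S.
Proof.
elim: S G => [//|s S IH] G; rewrite !ps_vsing_cons !IH; ring.
Qed.

Lemma ps_vsingM c F G S :
  ps_vsing (fun H => c * F H) G S = c * ps_vsing F G S.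
Proof. by elim: S G => [//|s S IH] G; rewrite !ps_vsing_cons !IH mulrBr. Qed.

Lemma chordC x y b b' : chord (Arrow x y b) = chord (Arrow y x b').
Proof. by rewrite /chord /= minC maxC. Qed.

Lemma weight_diff_vanish o : vanish 1 (weight true o - weight false o).
Proof. by case=> // _; case: o; rewrite psDE !psNE /ps_exp !expr0 subrr. Qed.

(** The two resolutions of a singular crossing share their chord, hence [C]; for each smoothing only
    a difference of weights remains, and it is divisible by x because every weight is -1 at x = 0.
    Each singular chord thus contributes a factor x. *)
Lemma vsing_state_sum_vanish C G S : vanish (size S) (ps_vsing (state_sum C) G S).
Proof.
elim/last_ind: S C => [|S s IH] C; first exact: vanish0.
rewrite size_rcons -add1n ps_vsing_rcons.
have -> : (fun H => state_sum C (Arrow s.1 s.2 true :: H) -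
                    state_sum C (Arrow s.2 s.1 false :: H)) =
  fun H =>
  (weight true true - weight false true) *
    state_sum (fun cs o => C (chord (Arrow s.1 s.2 true) :: cs) (true :: o)) H +
  (weight true false - weight false false) *
    state_sum (fun cs o => C (chord (Arrow s.1 s.2 true) :: cs) (false :: o)) H.
  apply/funext => H; rewrite !state_sum_cons /= (chordC s.2 s.1 false true).
  ring.
by rewrite ps_vsingD !ps_vsingM; apply: vanishD; apply: vanishM => //;
   exact: weight_diff_vanish.
Qed.

Lemma vk_kauffman_le k : kauffman_le (vk k) k.
Proof.
move=> G S _ kS; have := @vsing_state_sum_vanish
  (fun cs o => ps_delta ^+ loops (positive_diagram cs) o) G S k kS.
by rewrite (_ : state_sum _ = fK_ps) //; apply/funext => H; rewrite fK_state_sum.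
Qed.

(** * Components of the states of parallel chords *)

Lemma n_comp_label (T : finType) (e : rel T) (c : T -> nat) m :
  (forall x y, connect e x y <-> c x = c y) ->
  (forall x, (c x < m)%N) -> (forall i, (i < m)%N -> exists x, c x = i) ->
  n_comp e (@predT T) = m.
Proof.
move=> cE cm c_onto.
have sym_e : connect_sym e.
  by move=> x y; apply/idP/idP => /cE xy; apply/cE.
pose c' x := Ordinal (cm x).
rewrite /n_comp_mem -[RHS](card_ord m) -(@card_in_imset _ _ c').
  rewrite -[RHS]cardsT; apply: eq_card => i; rewrite !inE; apply/imsetP.
  have [x xi] := c_onto i (ltn_ord i).
  exists (fingraph.root e x); first by rewrite inE /= andbT; exact: roots_root.
  by apply/val_inj; rewrite /= -xi; apply/cE; exact: connect_root.
move=> x y; rewrite !inE /= !andbT => /eqP rx /eqP ry [cxy].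
rewrite -rx -ry; apply/eqP; rewrite (root_connect sym_e); exact/cE.
Qed.

(* [rho] gives equal values to joined segments: segment [i] of the line is the
   one arriving at the [i]-th endpoint, and chord [i] has endpoints [i] and
   [size o + i]. *)
Definition segment_invariant X (o : seq bool) (rho : nat -> X) := forall i,
  (i < size o)%N ->
  if nth true o i then rho i = rho (size o + i.+1)%N /\ rho (size o + i)%N = rho i.+1
  else rho i = rho (size o + i)%N /\ rho i.+1 = rho (size o + i.+1)%N.

Definition unor (o : seq bool) (j : nat) := count negb (take j o).

Lemma unorS o j : (j < size o)%N -> unor o j.+1 = (unor o j + ~~ nth true o j)%N.
Proof. by move=> jo; rewrite /unor (take_nth true) // -cats1 count_cat /= addn0. Qed.

Lemma unor_le o j : (unor o j <= count negb o)%N.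
Proof. by rewrite -{2}(cat_take_drop j o) count_cat leq_addr. Qed.

Lemma unor_size o : unor o (size o) = count negb o.
Proof. by rewrite /unor take_size. Qed.

Lemma unor_onto o v : (v <= count negb o)%N ->
  exists2 j, (j <= size o)%N & unor o j = v.
Proof.
elim: o v => [|b o IH] v /=; first by rewrite leqn0 => /eqP->; exists 0%N.
case: v => [_|v]; first by exists 0%N.
case: b => /= [|]; rewrite ?add0n ?add1n.
  by move=> /IH[j jo jv]; exists j.+1.
by rewrite ltnS => /IH[j jo jv]; exists j.+1; rewrite // /unor /= -jv.
Qed.

(** A name for the component of segment [s]. One unoriented smoothing forces segments [i] and
    [size o + i] together for every [i]; then oriented chords join consecutive segments, and only
    unoriented ones separate them. The modulus closes the cycle, since segment [size o] lies on both
    strands. If all smoothings are oriented, only parity can survive, and only for an odd number of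
    chords. *)
Definition label (o : seq bool) (s : nat) : nat :=
  if count negb o == 0%N then nat_of_bool (odd (size o) && odd s)
  else (unor o (if s <= size o then s else s - size o) %% count negb o)%N.

Lemma all_oriented o i : count negb o = 0%N -> nth true o i.
Proof.
move/eqP; rewrite -leqn0 leqNgt -has_count => /hasPn oT.
case: (ltnP i (size o)) => io; last by rewrite nth_default.
by have := oT _ (mem_nth true io); rewrite negbK.
Qed.

Lemma label_invariant o : segment_invariant o (label o).
Proof.
move=> i io; rewrite /label; case: (eqVneq (count negb o) 0%N) => [u0|u0].
  by rewrite all_oriented //; split; congr nat_of_bool; lia.
have i1 : (i <= size o)%N by lia.
have i2 : (size o + i.+1 <= size o)%N = false by lia.
(* For [i = 0] the segment [size o] is read as the end of the first strand, where [unor] is the full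
   count, congruent to 0. *)
have unorN : unor o (if size o + i <= size o then size o + i else size o + i - size o)%N
     = unor o i %[mod count negb o].
  case: ifP => [iN|_]; last by rewrite addKn.
  have -> : i = 0%N by lia.
  by rewrite addn0 unor_size modnn /unor take0 /= mod0n.
rewrite io i1 i2 addKn unorS //.
by case: ifP => /= oi; rewrite unorN ?oi ?addn0.
Qed.

(** Every invariant of joined segments factors through [label]. Taking component roots for [rho],
    this shows that equal labels imply connectedness. *)
Lemma label_universal X o (rho : nat -> X) s t :
  segment_invariant o rho -> (s <= 2 * size o)%N -> (t <= 2 * size o)%N ->
  label o s = label o t -> rho s = rho t.
Proof.
move=> inv sN tN; rewrite /label.
case: (eqVneq (count negb o) 0%N) => [u0|u0].
  have {}inv i : (i < size o)%N ->
      rho i = rho (size o + i.+1)%N /\ rho (size o + i)%N = rho i.+1.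
    by move=> io; have := inv i io; rewrite all_oriented.
  (* Two successive oriented chords lead to the second strand and back, advancing by two
     segments. *)
  have par j : (j <= size o)%N -> rho j = rho (odd j).
    elim/ltn_ind: j => -[|[|j]] IH // jo.
    rewrite -(inv j.+1 jo).2 -(inv j (ltnW jo)).1.
    by rewrite (IH j (leqnSn _) (ltnW (ltnW jo))) /= negbK.
  have par' j : (j <= 2 * size o)%N -> (size o < j)%N ->
      rho j = rho (odd (j - size o).-1).
    move=> j2 jo; rewrite -par; last by lia.
    have jN : ((j - size o).-1 < size o)%N by lia.
    by rewrite (inv _ jN).1; congr rho; lia.
  case oddN : (odd (size o)) => /=.
    have parA j : (j <= 2 * size o)%N -> rho j = rho (odd j).
      move=> j2; case: (leqP j (size o)) => jo; first exact: par.
      by rewrite par' //; congr rho; congr nat_of_bool; lia.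
    by move=> st; rewrite parA // (parA t) // st.
  move=> _.
  (* For even [size o] the shared segment [size o] links the two parities. *)
  have r1 : (0 < size o)%N -> rho 1%N = rho 0%N.
    move=> o0; rewrite -(inv 0%N o0).2 addn0 par //.
    by rewrite oddN.
  have zero j : (j <= 2 * size o)%N -> rho j = rho 0%N.
    move=> j2; case: (leqP j (size o)) => jo.
      by rewrite par //; case oddj: (odd j) => //=; apply: r1; lia.
    by rewrite par' //; case: (odd _) => //=; apply: r1; lia.
  by rewrite !zero.
(* Agreement of the two strands passes across a chord in both directions, so one unoriented chord
   propagates it everywhere. *)
have Dstep i : (i < size o)%N ->
    rho i = rho (size o + i)%N <-> rho i.+1 = rho (size o + i.+1)%N.
  move=> io; have := inv i io; case: ifP => _ [e1 e2]; last by split.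
  by rewrite e1 e2; split=> ->.
have D0 i : (i <= size o)%N ->
    rho i = rho (size o + i)%N <-> rho 0%N = rho (size o + 0)%N.
  elim: i => [//|i IH] io; rewrite -Dstep //; apply: IH; lia.
have D i : (i <= size o)%N -> rho (size o + i)%N = rho i.
  move=> io; apply/esym/D0 => //.
  have : has negb o by rewrite has_count lt0n.
  move/(has_nthP true) => [i0 i0o oi0].
  apply/(D0 i0); first by lia.
  by have := inv i0 i0o; rewrite (negbTE oi0) => -[].
have step i : (i < size o)%N -> nth true o i -> rho i = rho i.+1.
  by move=> io oi; have := inv i io; rewrite oi D //; case.
have same i j : (i <= j)%N -> (j <= size o)%N -> unor o i = unor o j -> rho i = rho j.
  elim: j => [|j IH]; first by rewrite leqn0 => /eqP->.
  rewrite leq_eqVlt => /orP[/eqP-> //|]; rewrite ltnS => ij jo.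
  have ij' : (unor o i <= unor o j)%N.
    by rewrite /unor -(take_takel o ij) -{2}(cat_take_drop i (take j o)) count_cat leq_addr.
  rewrite unorS // => e.
  have oj : nth true o j by case: (nth true o j) e ij' => //=; lia.
  by rewrite IH //; [exact: step | lia | rewrite e oj addn0].
have sameW i j : (i <= size o)%N -> (j <= size o)%N -> unor o i = unor o j -> rho i = rho j.
  by move=> io jo ij; case: (leqP i j) => [|/ltnW] h; [|symmetry]; apply: same.
have red j : (j <= 2 * size o)%N ->
    rho j = rho (if j <= size o then j else j - size o)%N.
  move=> j2; case: leqP => // jo; rewrite -(D (j - size o)%N); last by lia.
  by congr rho; lia.
rewrite (red s) // (red t) //.
have : ((if t <= size o then t else t - size o) <= size o)%N by case: ifP; lia.
have : ((if s <= size o then s else s - size o) <= size o)%N by case: ifP; lia.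
move: (if s <= _ then _ else _)%N (if t <= _ then _ else _)%N => {sN tN}s {}t so to.
have r0N : rho 0%N = rho (size o) by rewrite -(D 0%N) // addn0.
(* Representatives with [unor] below the modulus: the last stretch wraps around to segment 0 by
   [r0N]. *)
have norm j : (j <= size o)%N -> exists2 j', (j' <= size o)%N &
    (unor o j' < count negb o)%N /\ unor o j' = (unor o j %% count negb o)%N /\ rho j' = rho j.
  move=> jo; have := unor_le o j; rewrite leq_eqVlt => /orP[/eqP e|lt].
    have u00 : unor o 0 = 0%N by rewrite /unor take0.
    exists 0%N => //; rewrite u00 lt0n u0 e modnn; split=> //; split=> //.
    by rewrite r0N; apply: sameW => //; rewrite unor_size.
  by exists j => //; rewrite modn_small.
have [s' s'o [_ [us <-]]] := norm s so.
have [t' t'o [_ [ut <-]]] := norm t to.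
by rewrite -us -ut; apply: sameW.
Qed.

(** Sorting the concatenation also puts all first endpoints before all second ones, so chord [i]
    occupies positions [i] and [size cs + i]. *)
Definition parallel (cs : seq (rat * rat)) : bool :=
  sorted <%R (map fst cs ++ map snd cs).

Lemma endpoints_positive cs :
  perm_eq (endpoints (positive_diagram cs)) (map fst cs ++ map snd cs).
Proof.
elim: cs => [//|c cs IH]; rewrite /endpoints /= perm_cons.
by rewrite perm_sym -(cat1s c.2) perm_catCA /= perm_cons perm_sym.
Qed.

Lemma size_endpoints_positive cs :
  size (endpoints (positive_diagram cs)) = (2 * size cs)%N.
Proof.
by rewrite (perm_size (endpoints_positive cs)) size_cat !size_map; lia.
Qed.

Lemma positions_parallel cs : parallel cs ->
  positions (positive_diagram cs) = map fst cs ++ map snd cs.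
Proof.
rewrite /parallel lt_sorted_uniq_le => /andP[_ par].
rewrite -[RHS](@sorted_sort _ <=%R) //; last exact: le_trans.
apply/perm_sortP; [exact: le_total | exact: le_trans | exact: le_anti |].
exact: endpoints_positive.
Qed.

Lemma pidx_parallel cs i : parallel cs -> (i < size cs)%N ->
  pidx (positive_diagram cs) (nth (0, 0) cs i).1 = i /\
  pidx (positive_diagram cs) (nth (0, 0) cs i).2 = (size cs + i)%N.
Proof.
move=> par ics; rewrite /pidx positions_parallel //.
have uniq_cs : uniq (map fst cs ++ map snd cs) by exact: lt_sorted_uniq.
split.
  rewrite -(nth_map _ 0) // (_ : nth 0 _ i = nth 0 (map fst cs ++ map snd cs) i).
    by rewrite index_uniq // size_cat !size_map; lia.
  by rewrite nth_cat size_map ics.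
rewrite -(nth_map _ 0) //.
rewrite (_ : nth 0 _ i = nth 0 (map fst cs ++ map snd cs) (size cs + i)).
  by rewrite index_uniq // size_cat !size_map; lia.
by rewrite nth_cat size_map ltnNge leq_addr addKn.
Qed.

Definition parallel_chord_edges (o : seq bool) (i : nat) : seq (nat * nat) :=
  let j := (size o + i)%N in
  if nth true o i then [:: (2 * i + 1, 2 * j + 2)%N; (2 * j + 1, 2 * i + 2)%N]
  else [:: (2 * i + 1, 2 * j + 1)%N; (2 * i + 2, 2 * j + 2)%N].

Lemma zip_nth_iota (S T : Type) (x : S) (y : T) s t : size s = size t ->
  zip s t = [seq (nth x s i, nth y t i) | i <- iota 0 (size t)].
Proof.
move=> st; apply: (@eq_from_nth _ (x, y)).
  by rewrite size_zip size_map size_iota st minnn.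
move=> i; rewrite size_zip st minnn => it.
by rewrite nth_zip // (nth_map 0%N) ?size_iota // nth_iota.
Qed.

Lemma state_edges_parallel cs o : parallel cs -> size o = size cs ->
  state_edges (positive_diagram cs) o =
  line_edges (2 * size o) ++
  flatten [seq parallel_chord_edges o i | i <- iota 0 (size o)].
Proof.
move=> par szo; rewrite /state_edges size_endpoints_positive -szo; congr (_ ++ flatten _).
rewrite (@zip_nth_iota _ _ (Arrow 0 0 true) true) ?size_map //.
rewrite -map_comp; apply/eq_in_map => i; rewrite mem_iota add0n => /andP[_ io] /=.
have ics : (i < size cs)%N by rewrite -szo.
rewrite (nth_map (0, 0)) // /chord_edges /=.
have [-> ->] := pidx_parallel par ics.
by rewrite -szo /parallel_chord_edges eqb_id.
Qed.

(** The label of a node's segment is a complete invariant of its component: it is constant along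
    edges, and universality applied to roots gives the converse. *)
Lemma ncomp_parallel cs o : parallel cs -> size o = size cs ->
  ncomp (positive_diagram cs) o =
  if count negb o == 0%N then (odd (size o)).+1 else count negb o.
Proof.
move=> par szo; rewrite /ncomp state_edges_parallel // size_endpoints_positive -szo.
set E := _ ++ _; set M := (2 * (2 * _) + 2)%N; set N := size o.
have M_gt0 : (0 < M)%N by rewrite /M; lia.
pose node v : 'I_M := insubd (Ordinal M_gt0) v.
have nodeE v : (v < M)%N -> node v = v :> nat.
  by move=> vM; rewrite /node val_insubd vM.
have sym_e : connect_sym (@adj E M).
  by apply: sym_connect_sym => x y; rewrite /adj orbC.
pose rt v := fingraph.root (@adj E M) (node v).
have rt_edge v w : (v, w) \in E -> (v < M)%N -> (w < M)%N -> rt v = rt w.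
  move=> vw vM wM; apply/eqP; rewrite /rt (root_connect sym_e).
  by apply: connect1; rewrite /adj !nodeE // vw.
(* The line edge from [2i] to [2i + 1] reduces a node to its segment number [v./2]. *)
have rt_half v : (v < M)%N -> rt v = rt (2 * v./2)%N.
  move=> vM; case odd_v : (odd v); last by congr rt; lia.
  apply/esym/rt_edge => //; last by lia.
  rewrite mem_cat; apply/orP; left; apply/mapP; exists v./2.
    by rewrite mem_iota; move: vM; rewrite /M; lia.
  by congr pair; lia.
have chord_in v w i : (i < N)%N -> (v, w) \in parallel_chord_edges o i -> (v, w) \in E.
  move=> iN vw; rewrite mem_cat; apply/orP; right; apply/flatten_mapP.
  by exists i; rewrite // mem_iota.
have inv : segment_invariant o (fun s => rt (2 * s)%N).
  move=> i iN; have := chord_in _ _ _ iN; rewrite /parallel_chord_edges -/N.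
  have bounds : [/\ (2 * i + 1 < M)%N, (2 * i + 2 < M)%N,
      (2 * (N + i) + 1 < M)%N & (2 * (N + i) + 2 < M)%N].
    by rewrite /M -/N; split; lia.
  have [b1 b2 b3 b4] := bounds.
  have h1 : rt (2 * i + 1)%N = rt (2 * i)%N by rewrite rt_half //; congr rt; lia.
  have h2 : rt (2 * i + 2)%N = rt (2 * i.+1)%N by rewrite rt_half //; congr rt; lia.
  have h3 : rt (2 * (N + i) + 1)%N = rt (2 * (N + i))%N.
    by rewrite rt_half //; congr rt; lia.
  have h4 : rt (2 * (N + i) + 2)%N = rt (2 * (N + i.+1))%N.
    by rewrite rt_half //; congr rt; lia.
  case: ifP => _ inE'; rewrite -h1 -h2 -h3 -h4; split;
    (apply: rt_edge || apply/esym/rt_edge) => //; apply: inE';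
    by rewrite !inE !eqxx ?orbT.
have lab_edge v w : (v, w) \in E -> label o v./2 = label o w./2.
  rewrite mem_cat => /orP[/mapP[i _ [-> ->]]|]; first by congr label; lia.
  case/flatten_mapP=> i; rewrite mem_iota add0n => /andP[_ iN].
  have := label_invariant iN; rewrite /parallel_chord_edges -/N.
  have e1 : (2 * i + 1)./2 = i by lia.
  have e2 : (2 * i + 2)./2 = i.+1 by lia.
  have e3 : (2 * (N + i) + 1)./2 = (N + i)%N by lia.
  have e4 : (2 * (N + i) + 2)./2 = (N + i.+1)%N by lia.
  by case: ifP => _ [l1 l2]; rewrite !inE => /orP[] /eqP[-> ->]; rewrite ?e1 ?e2 ?e3 ?e4.
apply: (@n_comp_label _ _ (fun x : 'I_M => label o x./2)) => [x y|x|i].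
- split=> [/connectP[p]|lxy].
    elim: p x => [|z p IH] x /=; first by move=> _ ->.
    case/andP=> xz zp yE; rewrite -(IH _ zp yE).
    by case/orP: xz => /lab_edge.
  rewrite -(root_connect sym_e).
  have xE (z : 'I_M) : fingraph.root (@adj E M) z = rt (2 * z./2)%N.
    rewrite -rt_half // /rt; congr fingraph.root.
    by apply/val_inj; rewrite /= nodeE.
  rewrite !xE; apply/eqP; apply: (label_universal inv) => //;
    by [move: (ltn_ord x); rewrite /M; lia | move: (ltn_ord y); rewrite /M; lia].
- rewrite /label; case: eqP => [_|/eqP u0]; last by rewrite ltn_mod lt0n.
  by case: (odd (size o)); case: odd.
- have node_lab s : (s <= 2 * N)%N -> exists x : 'I_M, label o x./2 = label o s.
    by move=> sN; exists (node (2 * s)%N); rewrite nodeE; [congr label; lia | rewrite /M -/N; lia].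
  case: eqP => [u0|/eqP u0] im.
    have [|x xE] := node_lab i; first by move: im; rewrite -/N; lia.
    by exists x; rewrite xE /label u0 /=; move: im; rewrite -/N; lia.
  have [j jN ji] := unor_onto (ltnW im).
  have [|x xE] := node_lab j; first by rewrite /N; lia.
  by exists x; rewrite xE /label (negbTE u0) jN ji modn_small.
Qed.

(** * The normalised bracket of parallel chords *)

Lemma state_sumD C C' G :
  state_sum (fun cs o => C cs o + C' cs o) G = state_sum C G + state_sum C' G.
Proof. by rewrite /state_sum -big_split; apply: eq_bigr => o _; rewrite mulrDr. Qed.

Lemma state_sumM c C G :
  state_sum (fun cs o => c * C cs o) G = c * state_sum C G.
Proof. by rewrite /state_sum mulr_sumr; apply: eq_bigr => o _; rewrite mulrCA. Qed.

Lemma state_sum_prod (x y : ps) G :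
  state_sum (fun _ o => \prod_(b <- o) if b then x else y) G =
  \prod_(a <- G) (weight (sgn a) true * x + weight (sgn a) false * y).
Proof.
elim: G => [|a G IH]; first by rewrite /state_sum /= big_seq1 !big_nil mulr1.
rewrite state_sum_cons big_cons -IH.
have cons_sum b : state_sum (fun _ o => \prod_(c <- b :: o) if c then x else y) G =
    (if b then x else y) * state_sum (fun _ o => \prod_(c <- o) if c then x else y) G.
  by rewrite -state_sumM; apply: state_sum_eq => o _; rewrite big_cons.
by rewrite !cons_sum; ring.
Qed.

(* The last product is the indicator of the state without unoriented smoothing. *)
Lemma delta_loops_parallel cs o : parallel cs -> size o = size cs ->
  ps_delta * ps_delta ^+ loops (positive_diagram cs) o =
  \prod_(b <- o) (if b then 1 else ps_delta) +
  (ps_delta ^+ (odd (size cs)).+1 - 1) * \prod_(b <- o) (if b then 1 else 0).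
Proof.
move=> par szo; rewrite -exprS /loops ncomp_parallel // szo.
have prodE (y : ps) : \prod_(b <- o) (if b then 1 else y) = y ^+ count negb o.
  elim: (o) => [|b o' IH]; first by rewrite big_nil.
  by rewrite big_cons IH; case: b; rewrite ?mul1r //= exprS.
rewrite !prodE; case: (eqVneq (count negb o) 0%N) => [->|u0].
  by rewrite !expr0 mulr1 addrCA subrr addr0.
by rewrite expr0n (negbTE u0) mulr0 addr0 prednK // lt0n.
Qed.

(** The image of a chord under the character sending [s] to 1 and [e] to delta. *)
Definition cupcap_eigenvalue (b : bool) : ps := weight b true + weight b false * ps_delta.

(** Multiplying by delta makes up for the uncounted long component. Multiplying by 2 lets the
    parity-dependent exponent of the all-oriented state split into a constant part and a part
    alternating as (-1)^n. *)
Lemma fK_parallel G : parallel (map chord G) ->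
  2 * ps_delta * fK_ps G =
  2 * \prod_(a <- G) cupcap_eigenvalue (sgn a)
  + (ps_delta ^+ 2 + ps_delta - 2) * \prod_(a <- G) weight (sgn a) true
  + (ps_delta - ps_delta ^+ 2) * \prod_(a <- G) - weight (sgn a) true.
Proof.
move=> par; rewrite -mulrA fK_state_sum -state_sumM.
rewrite (@state_sum_eq _ (fun cs o => \prod_(b <- o) (if b then 1 else ps_delta) +
  (ps_delta ^+ (odd (size G)).+1 - 1) * \prod_(b <- o) (if b then 1 else 0))); last first.
  by move=> o szo; rewrite delta_loops_parallel ?size_map.
rewrite state_sumD state_sumM !state_sum_prod.
have -> : \prod_(a <- G) (weight (sgn a) true * 1 + weight (sgn a) false * ps_delta) =
    \prod_(a <- G) cupcap_eigenvalue (sgn a).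
  by apply: eq_bigr => a _; rewrite mulr1.
have -> : \prod_(a <- G) (weight (sgn a) true * 1 + weight (sgn a) false * 0) =
    \prod_(a <- G) weight (sgn a) true.
  by apply: eq_bigr => a _; rewrite mulr1 mulr0 addr0.
have -> : \prod_(a <- G) - weight (sgn a) true =
    (-1) ^+ size G * \prod_(a <- G) weight (sgn a) true.
  elim: (G) => [|a G' IH]; first by rewrite !big_nil expr0 mulr1.
  by rewrite !big_cons IH exprS; ring.
rewrite -signr_odd.
by case: (odd (size G)); rewrite ?expr1 ?expr0; ring.
Qed.

(** Resolved arrows are prepended one by one, hence the [catrev]; all resolutions have this same
    chord list, so a formula for parallel diagrams applies to each. *)
Lemma ps_vsing_eq F F' G S :
  parallel (catrev [seq chord (Arrow s.1 s.2 true) | s <- S] (map chord G)) ->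
  (forall H, parallel (map chord H) -> F H = F' H) ->
  ps_vsing F G S = ps_vsing F' G S.
Proof.
move=> par FF'; elim: S G par => [|s S IH] G par; first exact: FF'.
by rewrite !ps_vsing_cons !IH //= (chordC s.2 s.1 false true).
Qed.

Lemma parallel_subseq cs cs' : subseq cs cs' -> parallel cs' -> parallel cs.
Proof.
move=> sub; apply: (subseq_sorted lt_trans).
by apply: cat_subseq; apply: map_subseq.
Qed.

(** Here the resolutions delete arrows, and parallelism passes to sublists of chords. *)
Lemma ps_vsv_eq F F' G T :
  parallel (catrev (map chord T) (map chord G)) ->
  (forall H, parallel (map chord H) -> F H = F' H) ->
  ps_vsv F G T = ps_vsv F' G T.
Proof.
move=> par FF'; elim: T G par => [|a T IH] G par; first exact: FF'.
rewrite !ps_vsv_cons !IH //=; apply: parallel_subseq par.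
by rewrite /= !catrevE; apply: cat_subseq => //; exact: subseq_cons.
Qed.

Lemma ps_vsvD F F' G T :
  ps_vsv (fun H => F H + F' H) G T = ps_vsv F G T + ps_vsv F' G T.
Proof. by elim: T G => [//|a T IH] G; rewrite !ps_vsv_cons !IH; ring. Qed.

Lemma ps_vsvM c F G T :
  ps_vsv (fun H => c * F H) G T = c * ps_vsv F G T.
Proof. by elim: T G => [//|a T IH] G; rewrite !ps_vsv_cons !IH mulrBr. Qed.

Lemma ps_vsing_prod (phi : bool -> ps) G S :
  ps_vsing (fun H => \prod_(a <- H) phi (sgn a)) G S =
  (phi true - phi false) ^+ size S * \prod_(a <- G) phi (sgn a).
Proof.
elim: S G => [|s S IH] G; first by rewrite expr0 mul1r.
by rewrite ps_vsing_cons !IH !big_cons exprS /=; ring.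
Qed.

Lemma ps_vsv_prod (phi : bool -> ps) G T : all sgn T ->
  ps_vsv (fun H => \prod_(a <- H) phi (sgn a)) G T =
  (phi true - 1) ^+ size T * \prod_(a <- G) phi (sgn a).
Proof.
elim: T G => [|a T IH] G /=; first by rewrite expr0 mul1r.
by case/andP=> sa pT; rewrite ps_vsv_cons !IH // big_cons sa exprS; ring.
Qed.

Lemma vsing_fK_parallel S :
  parallel (rev [seq chord (Arrow s.1 s.2 true) | s <- S]) ->
  2 * ps_delta * ps_vsing fK_ps [::] S =
  2 * (cupcap_eigenvalue true - cupcap_eigenvalue false) ^+ size S
  + (ps_delta ^+ 2 + ps_delta - 2) * (weight true true - weight false true) ^+ size S
  + (ps_delta - ps_delta ^+ 2) * (weight false true - weight true true) ^+ size S.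
Proof.
move=> par; rewrite -ps_vsingM (@ps_vsing_eq _ _ [::] S par fK_parallel).
rewrite !ps_vsingD !ps_vsingM (ps_vsing_prod cupcap_eigenvalue).
rewrite (ps_vsing_prod (fun b => weight b true)).
rewrite (ps_vsing_prod (fun b => - weight b true)) !big_nil !mulr1.
by congr (_ + _ * _ ^+ _); ring.
Qed.

Lemma vsv_fK_parallel T : all sgn T -> parallel (rev (map chord T)) ->
  2 * ps_delta * ps_vsv fK_ps [::] T =
  2 * (cupcap_eigenvalue true - 1) ^+ size T
  + (ps_delta ^+ 2 + ps_delta - 2) * (weight true true - 1) ^+ size T
  + (ps_delta - ps_delta ^+ 2) * (- weight true true - 1) ^+ size T.
Proof.
move=> pT par; rewrite -ps_vsvM (@ps_vsv_eq _ _ [::] T par fK_parallel).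
rewrite !ps_vsvD !ps_vsvM (ps_vsv_prod cupcap_eigenvalue) //.
rewrite (ps_vsv_prod (fun b => weight b true)) //.
by rewrite (ps_vsv_prod (fun b => - weight b true)) // !big_nil !mulr1.
Qed.

(** * Low-order coefficients and cancellation of a factor with nonzero constant term *)

Lemma coef0M (f g : ps) : (f * g) 0%N = f 0%N * g 0%N.
Proof. by rewrite psME big_ord1. Qed.

Lemma coef1M (f g : ps) : (f * g) 1%N = f 0%N * g 1%N + f 1%N * g 0%N.
Proof. by rewrite psME !big_ord_recl big_ord0 addr0. Qed.

Lemma coef0X (f : ps) n : (f ^+ n) 0%N = f 0%N ^+ n.
Proof. by elim: n => [//|n IH]; rewrite !exprS coef0M IH. Qed.

Lemma ps_natE m n : (m%:R : ps) n = if n == 0%N then m%:R else 0.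
Proof.
elim: m => [|m IH]; first by rewrite if_same.
by rewrite !mulrS psDE IH ps1E; case: n {IH} => [|n]; rewrite /= ?addr0.
Qed.

Lemma ps_exp_0 j : ps_exp j 0 = 1.
Proof. by rewrite /ps_exp expr0 fact0 divr1. Qed.

Lemma ps_exp_1 j : ps_exp j 1 = j%:~R.
Proof. by rewrite /ps_exp expr1 divr1. Qed.

Lemma ps_delta_0 : ps_delta 0%N = -2.
Proof. by rewrite /ps_delta /ps_add /ps_opp !ps_exp_0; ring. Qed.

Lemma ps_delta_1 : ps_delta 1%N = 0.
Proof. by rewrite /ps_delta /ps_add /ps_opp !ps_exp_1. Qed.

Lemma ps_delta_2 : ps_delta 2%N = -4.
Proof. by rewrite /ps_delta /ps_add /ps_opp /ps_exp; vm_compute. Qed.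

Lemma vanish_cancel (c f : ps) n : c 0%N != 0 -> vanish n (c * f) -> vanish n f.
Proof.
move=> c0 cf; elim: n cf => [|n IH] cf; first exact: vanish0.
have fn : vanish n f by apply: IH; apply: vanishW cf.
move=> i; rewrite ltnS leq_eqVlt => /orP[/eqP->|]; last exact: fn.
have := cf n (ltnSn n); rewrite -[X in (c * f) X]add0n coef_vanishM //.
by move/eqP; rewrite mulf_eq0 (negbTE c0) => /eqP.
Qed.

Lemma two_delta_0 : (2 * ps_delta) 0%N = -4.
Proof. by rewrite coef0M ps_natE ps_delta_0. Qed.

Definition low_coefE := (coef0M, coef1M, psDE, psNE, ps_natE, ps1E, ps_delta_0,
  ps_delta_1, ps_exp_0, ps_exp_1).

Lemma vanish1 f : f 0%N = 0 -> vanish 1 f.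
Proof. by move=> f0 []. Qed.

(** * Twist sequences *)

(** An infinite increasing sequence inside (0, 1), so that one choice of endpoints serves any number
    of twists. *)
Definition end_a (i : nat) : rat := 1 - (i.+2)%:R^-1.
Definition end_b (i : nat) : rat := 1 + end_a i.

Lemma end_a_bounds i : 0 < end_a i < 1.
Proof.
rewrite /end_a subr_gt0 invf_lt1 ?ltr0n // ltr1n /=.
by rewrite gtrBl invr_gt0 ltr0n.
Qed.

Lemma end_a_incr i j : (i < j)%N -> end_a i < end_a j.
Proof.
by move=> ij; rewrite /end_a ltrD2l ltrN2 ltf_pV2 ?posrE ?ltr0n // ltr_nat.
Qed.

Definition twist_chords n : seq (rat * rat) :=
  [seq (end_a i, end_b i) | i <- iota 0 n].

Lemma sorted_map_iota (f : nat -> rat) n : {homo f : i j / (i < j)%N >-> i < j} ->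
  sorted <%R (map f (iota 0 n)).
Proof. by move=> fincr; apply: (homo_sorted fincr); exact: iota_ltn_sorted. Qed.

Lemma end_b_incr i j : (i < j)%N -> end_b i < end_b j.
Proof. by move=> ij; rewrite ltrD2l; exact: end_a_incr. Qed.

Lemma parallel_twist_chords n : parallel (twist_chords n).
Proof.
rewrite /parallel -!map_comp sorted_pairwise; last exact: lt_trans.
rewrite pairwise_cat -!sorted_pairwise; try exact: lt_trans.
rewrite !sorted_map_iota ?andbT; [|exact: end_b_incr|exact: end_a_incr].
apply/allrelP => x y /mapP[i _ ->] /mapP[j _ ->] /=.
have /andP[_ ai] := end_a_bounds i; have /andP[aj _] := end_a_bounds j.
by rewrite /end_b; lra.
Qed.

Lemma chord_lt x y b : x < y -> chord (Arrow x y b) = (x, y).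
Proof. by move=> xy; rewrite /chord /= min_l ?max_r // ltW. Qed.

Lemma end_ab i : end_a i < end_b i.
Proof. by rewrite /end_b; lra. Qed.

Definition twist_diagram n : gauss := positive_diagram (twist_chords n).

Lemma chord_twist_diagram n : map chord (twist_diagram n) = twist_chords n.
Proof.
rewrite /twist_diagram /positive_diagram -!map_comp; apply: eq_map => i /=.
exact/chord_lt/end_ab.
Qed.

(** On [k] parallel singular chords the three terms have x^k coefficients 2 (-12)^k, 0 and -6
    (-4)^k; the middle one drops out because delta^2 + delta - 2 vanishes at delta = -2. *)
Lemma vk_not_kauffman_le k : (2 <= k)%N -> ~ kauffman_le (vk k) k.-1.
Proof.
move=> k2 vk_le; set S := rev (twist_chords k).
have sS : size S = k by rewrite size_rev size_map size_iota.
have par : parallel (rev [seq chord (Arrow s.1 s.2 true) | s <- S]).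
  rewrite -map_rev revK (map_comp chord (fun s => Arrow s.1 s.2 true)).
  by rewrite -/(twist_diagram k) chord_twist_diagram parallel_twist_chords.
have wfS : wf_gauss ([::] ++ [seq Arrow s.1 s.2 true | s <- S]).
  rewrite /wf_gauss (perm_uniq (endpoints_positive S)).
  rewrite (@perm_uniq _ _ (map fst (twist_chords k) ++ map snd (twist_chords k))).
    exact: lt_sorted_uniq (parallel_twist_chords k).
  by apply: perm_cat; apply: perm_map; rewrite perm_rev.
have kS : (k.-1 < size S)%N by rewrite sS; lia.
have h0 : ps_vsing fK_ps [::] S k = 0 := vk_le [::] S wfS kS.
have hk : vanish k (ps_vsing fK_ps [::] S).
  rewrite -{1}sS (_ : fK_ps = state_sum (fun cs o => ps_delta ^+ loops (positive_diagram cs) o)).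
    exact: vsing_state_sum_vanish.
  by apply/funext => H; rewrite fK_state_sum.
have := congr1 (fun f : ps => f (0 + k)%N) (vsing_fK_parallel par).
rewrite coef_vanishM // h0 mulr0 sS !psDE.
set a := cupcap_eigenvalue true - _; set b := weight true true - _.
set c := weight false true - _.
have [a0 a1] : a 0%N = 0 /\ a 1%N = -12.
  by rewrite /a /cupcap_eigenvalue /weight !low_coefE /=; split; ring.
have [b0 b1] : b 0%N = 0 /\ b 1%N = 4.
  by rewrite /b /weight !low_coefE /=; split; ring.
have [c0 c1] : c 0%N = 0 /\ c 1%N = -4.
  by rewrite /c /weight !low_coefE /=; split; ring.
rewrite (coef_vanishM (vanish0 2) (@vanishX _ k (vanish1 a0))).
rewrite (coef_vanishM (vanish0 (_ - 2)) (@vanishX _ k (vanish1 b0))).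
rewrite (coef_vanishM (vanish0 (_ - _)) (@vanishX _ k (vanish1 c0))).
rewrite (@coef_vanishX _ k (vanish1 a0)) (@coef_vanishX _ k (vanish1 b0)).
rewrite (@coef_vanishX _ k (vanish1 c0)) a1 b1 c1 expr2 !low_coefE /=.
have -> : -12 = 3 * -4 :> rat by ring.
have : (-4 : rat) ^+ k != 0 by rewrite expf_neq0.
rewrite exprMn; move: ((-4) ^+ k) => u u0.
(* The sum of the three is (-4)^k (2 * 3^k - 6), nonzero once [k] exceeds 1. *)
have h3 : (3 : rat) < 3 ^+ k.
  by rewrite -[X in X < _]expr1 ltr_eXn2l.
move=> eq0.
have : u * (2 * 3 ^+ k - 6) = 0 by rewrite [RHS]eq0; ring.
move/eqP; rewrite mulf_eq0 (negbTE u0) /= => /eqP; move: h3; clear.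
by move: (3 ^+ k) => x; lra.
Qed.

(* For large [m] the first and third terms are divisible by x^(k+1); the second
   base is [-2] at [x = 0], so applying (shift + 2)^(k - 2) in [m] brings the
   second term to order exactly [k]. *)
Lemma alternating_part_nonzero k (H : nat -> ps) n : (2 <= k)%N ->
  (forall m, 2 * ps_delta * H m =
     2 * (cupcap_eigenvalue true - 1) ^+ m
     + (ps_delta ^+ 2 + ps_delta - 2) * (weight true true - 1) ^+ m
     + (ps_delta - ps_delta ^+ 2) * (- weight true true - 1) ^+ m) ->
  ~ (forall m, (n < m)%N -> H m k = 0).
Proof.
set mu0 := cupcap_eigenvalue true - 1; set mu1 := weight true true - 1.
set mu2 := - weight true true - 1; set e1 := ps_delta ^+ 2 + _ - _.
set e2 := ps_delta - _.
move=> k2 HE Hk.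
pose Q (F : nat -> ps) : nat -> ps := fun m => F m.+1 + (F m + F m).
have QS F m : Q F m = F m.+1 + (F m + F m) by [].
(* Shift plus 2 multiplies the sequence mu^m by mu + 2. *)
have QE j m : 2 * ps_delta * iter j Q H m =
    2 * (mu0 + 2) ^+ j * mu0 ^+ m + e1 * (mu1 + 2) ^+ j * mu1 ^+ m
    + e2 * (mu2 + 2) ^+ j * mu2 ^+ m.
  elim: j m => [|j IH] m; first by rewrite HE !expr0 !mulr1.
  rewrite iterS QS !(mulrDr (2 * ps_delta)) !IH !exprS; ring.
have Qk j m : (n < m)%N -> iter j Q H m k = 0.
  elim: j m => [|j IH] m nm; first exact: Hk.
  rewrite iterS QS !psDE !IH ?addr0 //.
  exact: ltnW.
(* Large enough both for the hypothesis beyond [n] and for the outer terms to vanish to order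
   [k.+1]. *)
pose m := (n + k).+1.
have [mu00 mu20] : mu0 0%N = 0 /\ mu2 0%N = 0.
  by rewrite /mu0 /mu2 /cupcap_eigenvalue /weight !low_coefE /=; split; ring.
have [mu10 mu12 mu121] : [/\ mu1 0%N = -2, (mu1 + 2) 0%N = 0 & (mu1 + 2) 1%N = 2].
  by rewrite /mu1 /weight !low_coefE /=; split; ring.
(* The factor delta + 2 starts at -4 x^2 and delta - 1 at -3, whence order 2 and leading coefficient
   12. *)
have e1E : e1 = (ps_delta + 2) * (ps_delta - 1) by rewrite /e1; ring.
have d2 : vanish 2 (ps_delta + 2).
  by case=> [|[|]] // _; rewrite !low_coefE /=; ring.
have ve1 : vanish 2 e1 by rewrite e1E -[2%N]addn0; apply: vanishM.
have e12 : e1 2%N = 12.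
  rewrite e1E (coef_vanishM d2 (vanish0 (ps_delta - 1))) !low_coefE ps_delta_2 /=; ring.
have vmid : vanish (k - 2) ((mu1 + 2) ^+ (k - 2)) by exact/vanishX/vanish1.
have vl : vanish k (e1 * (mu1 + 2) ^+ (k - 2)).
  by rewrite -{1}(subnKC k2); exact: vanishM.
have mid : vanish k (e1 * (mu1 + 2) ^+ (k - 2) * mu1 ^+ m).
  by rewrite -{1}[k]addn0; exact: vanishM.
have outer (c mu : ps) : mu 0%N = 0 -> vanish k.+1 (c * mu ^+ m).
  move=> mu_0; apply: (@vanishW _ m); first by rewrite /m; lia.
  by rewrite -[m]add0n; apply: vanishM => //; exact/vanishX/vanish1.
have low : vanish k (2 * ps_delta * iter (k - 2) Q H m).
  rewrite QE; apply: vanishD; first apply: vanishD => //.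
    by apply: (vanishW (leqnSn k)); exact: outer.
  by apply: (vanishW (leqnSn k)); exact: outer.
have := congr1 (fun f : ps => f (0 + k)%N) (QE (k - 2)%N m).
(* As [2 * ps_delta] has constant term -4, the iterate itself vanishes to order [k], so the left
   side has x^k coefficient -4 times that of the iterate, which is 0. The right side gives 12 *
   2^(k-2) * (-2)^m. *)
rewrite coef_vanishM //; last by apply: vanish_cancel low; rewrite two_delta_0.
rewrite Qk ?mulr0; last by rewrite /m; lia.
rewrite add0n !psDE (outer _ _ mu00 k) // (outer _ _ mu20 k) // add0r addr0.
have := coef_vanishM vl (vanish0 (mu1 ^+ m)); rewrite addn0 => ->.
have := coef_vanishM ve1 vmid; rewrite subnKC // => ->.
rewrite e12 (@coef_vanishX _ _ (vanish1 mu12)).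
rewrite mu121 coef0X mu10 => /esym/eqP.
by rewrite !mulf_eq0 !expf_eq0 /= !andbF.
Qed.

(** Making [m] positive parallel chords semi-virtual replaces each base by its [m]-th power after
    subtracting 1, as [alternating_part_nonzero] requires. *)
Lemma vk_not_gpv_le k n : (2 <= k)%N -> ~ gpv_le (vk k) n.
Proof.
move=> k2 vk_le; pose T m := rev (twist_diagram m).
have parT m : parallel (rev (map chord (T m))).
  by rewrite -map_rev revK chord_twist_diagram parallel_twist_chords.
have pT m : all sgn (T m) by rewrite all_rev /twist_diagram; elim: (twist_chords m).
have sT m : size (T m) = m by rewrite size_rev !size_map size_iota.
apply: (@alternating_part_nonzero k (fun m => ps_vsv fK_ps [::] (T m)) n k2) => m.
  by rewrite vsv_fK_parallel // sT.
move=> nm; apply: vk_le; last by rewrite sT.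
rewrite cat0s /wf_gauss; have := lt_sorted_uniq (parallel_twist_chords m).
rewrite -(perm_uniq (endpoints_positive (twist_chords m))) => uniq_m.
rewrite (_ : T m = positive_diagram (rev (twist_chords m))); last by rewrite /T -map_rev.
rewrite (perm_uniq (endpoints_positive _)) (@perm_uniq _ _ (endpoints (twist_diagram m))) //.
rewrite perm_sym (perm_trans (endpoints_positive _)) //.
by apply: perm_cat; apply: perm_map; rewrite perm_sym perm_rev.
Qed.

Definition twist_family (z : int) : gauss :=
  twist_arrows TS TR z (mkseq end_a `|z|%N) (mkseq end_b `|z|%N).

Lemma twist_family_nat n : twist_family n%:Z = twist_diagram n.
Proof.
rewrite /twist_family /twist_arrows /twist_diagram /positive_diagram /twist_chords /mkseq /=.
by elim: (iota 0 n) => [//|i s IH] /=; rewrite IH.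
Qed.

Lemma twist_family_sequence : twist_sequence twist_family.
Proof.
exists [::], 0, 1, 1, 2, TS, TR; split; [by []|split; [by []|split; [by []|]]].
move=> z; exists (mkseq end_a `|z|%N), (mkseq end_b `|z|%N); split=> //.
- by rewrite !size_mkseq.
- by split; apply: sorted_map_iota; [exact: end_a_incr | exact: end_b_incr].
- split; apply/allP => x /mapP[i _ ->]; have := end_a_bounds i; rewrite /in_open //.
  by rewrite /end_b => /andP[]; lra.
Qed.

(** Differencing lambda^i [m] times at i = 0 gives (lambda - 1)^m, the same expression as for [m]
    semi-virtual chords. Only nonnegative twists are evaluated. *)
Lemma vk_twist_not_poly k n : (2 <= k)%N ->
  ~ poly_le n (fun z => vk k (twist_family z)).
Proof.
move=> k2 poly_n.
pose D (F : nat -> ps) : nat -> ps := fun i => F i.+1 - F i.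
pose F i := fK_ps (twist_diagram i).
have DS X i : D X i = X i.+1 - X i by [].
have fdiffE m i : iter m fdiff (fun z => vk k (twist_family z)) i%:Z = iter m D F i k.
  elim: m i => [|m IH] i; first by rewrite /= twist_family_nat.
  by rewrite !iterS DS psDE psNE -!IH /fdiff -[i.+1]addn1 PoszD.
have prodE (phi : bool -> ps) i :
    \prod_(a <- twist_diagram i) phi (sgn a) = phi true ^+ i.
  rewrite /twist_diagram big_map big_map /= big_const_seq count_predT size_iota.
  by elim: i => [//|i IH]; rewrite iterS IH exprS.
have DE m i : 2 * ps_delta * iter m D F i =
    2 * (cupcap_eigenvalue true - 1) ^+ m * cupcap_eigenvalue true ^+ i
    + (ps_delta ^+ 2 + ps_delta - 2) * (weight true true - 1) ^+ m * weight true true ^+ i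
    + (ps_delta - ps_delta ^+ 2) * (- weight true true - 1) ^+ m * (- weight true true) ^+ i.
  elim: m i => [|m IH] i.
    rewrite !expr0 !mulr1 fK_parallel ?chord_twist_diagram ?parallel_twist_chords //.
    rewrite (prodE cupcap_eigenvalue) (prodE (fun b => weight b true)).
    by rewrite (prodE (fun b => - weight b true)).
  by rewrite iterS DS (mulrBr (2 * ps_delta)) !IH !exprS; ring.
apply: (@alternating_part_nonzero k (fun m => iter m D F 0%N) n k2) => m.
  by rewrite DE !expr0 !mulr1.
by move=> nm; rewrite -fdiffE; exact: poly_n.
Qed.

Theorem theorem2 (k : nat) (hk : (2 <= k)%N) :
  kauffman_deg (vk k) k /\
  (forall n : nat, ~ gpv_le (vk k) n) /\
  exists Phi : int -> gauss, twist_sequence Phi /\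
    forall n : nat, ~ poly_le n (fun z => vk k (Phi z)).
Proof.
split; first by split; [exact: vk_kauffman_le | exact: vk_not_kauffman_le].
split=> [n|]; first exact: vk_not_gpv_le.
exists twist_family; split; first exact: twist_family_sequence.
by move=> n; exact: vk_twist_not_poly.
Qed.
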